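(* Given $\nu>0$, $T>0$ and $r>0$, and given $\rho$ equal either to $\rho(x)=\langle x\rangle^{-\nu}$, $x\in\mathbb{R}^n$, or to $\rho(x)=e^{-|x|}$, $x\in\mathbb{R}^n$, there is no constant $C=C(T,r,\nu,n)>0$ so that $$\int_{\mathbb{R}^n}u^2(T,x)\rho(x)\,dx\le C\int_0^T\int_{B_r}u^2(t,x)\,dx\,dt$$ for every solution $u$ of the heat equation.
   Context: The heat equation is $\partial_t u-\Delta u=0$ in $(0,\infty)\times\mathbb{R}^n$, $u(0,\cdot)\in L^2(\mathbb{R}^n)$; its solution is $u(t,\cdot)=e^{t\Delta}u(0,\cdot)$, where $\{e^{t\Delta}\}_{t\ge0}$ is the heat semigroup (convolution with $(4\pi t)^{-n/2}e^{-|x|^2/(4t)}$ for $t>0$). Solutions are real-valued. $B_r$ is the open ball in $\mathbb{R}^n$ centered at $0$ of radius $r$, and $\langle x\rangle=\sqrt{1+|x|^2}$. *)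

(* Defs.v *)
From HB Require Import structures.
From mathcomp Require Import all_boot all_order all_algebra.
From mathcomp Require Import all_classical all_reals all_analysis.

Set Implicit Arguments.
Unset Strict Implicit.
Unset Printing Implicit Defensive.

Import Order.TTheory GRing.Theory Num.Theory.
Import numFieldNormedType.Exports.

Local Open Scope classical_set_scope.
Local Open Scope ring_scope.

Section cons_measure.
Context {d} {T : measurableType d} {R : realType} {n : nat}.

Definition cons_pair (p : T * n.-tuple T) : n.+1.-tuple T :=
  [the n.+1.-tuple T of p.1 :: p.2].

Lemma measurable_cons_pair : measurable_fun setT cons_pair.
Proof. exact: measurable_cons. Qed.

Definition uncons_pair (x : n.+1.-tuple T) : T * n.-tuple T :=
  (tnth x ord0, [tuple of behead x]).

Lemma measurable_uncons_pair : measurable_fun setT uncons_pair.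
Proof.
apply/measurable_fun_pairP; split; first exact: measurable_tnth.
exact: measurable_behead.
Qed.

Lemma cons_pairK : cancel cons_pair uncons_pair.
Proof. by move=> [a b]; congr pair; apply/val_inj. Qed.

Variables (m : {sigma_finite_measure set T -> \bar R})
  (mu : {sigma_finite_measure set (n.-tuple T) -> \bar R}).

Definition cons_measure : set (n.+1.-tuple T) -> \bar R :=
  pushforward (m \x mu)%E cons_pair.

Let cons_measure0 : cons_measure set0 = 0%E.
Proof. by rewrite /cons_measure /pushforward preimage_set0 measure0. Qed.

Let cons_measure_ge0 A : (0 <= cons_measure A)%E.
Proof. by rewrite /cons_measure /pushforward measure_ge0. Qed.

Let cons_measure_sigma_additive : semi_sigma_additive cons_measure.
Proof.
move=> F mF tF mUF; rewrite /cons_measure /pushforward preimage_bigcup.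
have mc A : measurable A -> measurable (cons_pair @^-1` A).
  by move=> mA; rewrite -[X in measurable X]setTI; exact: measurable_cons_pair.
apply: measure_semi_sigma_additive.
- by move=> k; exact: mc.
- apply/trivIsetP => /= i j _ _ ij; rewrite -preimage_setI.
  by move/trivIsetP : tF => /(_ _ _ _ _ ij) ->//; rewrite preimage_set0.
- by rewrite -preimage_bigcup; exact: mc.
Qed.

HB.instance Definition _ := isMeasure.Build _ _ _ cons_measure
  cons_measure0 cons_measure_ge0 cons_measure_sigma_additive.

Let cons_measure_sigma_finite : sigma_finite setT cons_measure.
Proof.
have /sigma_finiteP[F [TF ndF Foo]] := sigma_finiteT m.
have /sigma_finiteP[G [TG ndG Goo]] := sigma_finiteT mu.
exists (fun k => uncons_pair @^-1` (F k `*` G k)).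
  rewrite -preimage_bigcup -[LHS](preimage_setT uncons_pair); congr (_ @^-1` _).
  rewrite -setXTT TF TG predeqE => -[x y]; split.
    move=> [/= [i _ Fix] [j _ Gjy]]; exists (maxn i j) => //; split.
    - by move: x Fix; exact/subsetPset/ndF/leq_maxl.
    - by move: y Gjy; exact/subsetPset/ndG/leq_maxr.
  by move=> [i _ []/= ? ?]; split; exists i.
move=> k; have [mF Fk] := Foo k; have [mG Gk] := Goo k; split.
  rewrite -[X in measurable X]setTI; apply: measurable_uncons_pair => //.
  exact: measurableX.
rewrite /cons_measure /pushforward -comp_preimage.
rewrite (_ : uncons_pair \o cons_pair = id) ?preimage_id; last first.
  by apply/funext => p /=; rewrite cons_pairK.
by rewrite product_measure1E// lte_mul_pinfty// ge0_fin_numE.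
Qed.

HB.instance Definition _ := Measure_isSigmaFinite.Build _ _ _ cons_measure
  cons_measure_sigma_finite.

End cons_measure.

Section nil_measure.
Context {d} {T : measurableType d} {R : realType}.

Definition nil_measure : set (0.-tuple T) -> \bar R := \d_ [tuple].

HB.instance Definition _ := Measure.on nil_measure.

Let nil_measure_sigma_finite : sigma_finite setT nil_measure.
Proof.
apply: fin_num_fun_sigma_finite; first by rewrite measure0.
by move=> A mA; rewrite /nil_measure diracE.
Qed.

HB.instance Definition _ := Measure_isSigmaFinite.Build _ _ _ nil_measure
  nil_measure_sigma_finite.

End nil_measure.

Fixpoint power_measure d (T : measurableType d) (R : realType)
    (m : {sigma_finite_measure set T -> \bar R}) (n : nat) :
    {sigma_finite_measure set (n.-tuple T) -> \bar R} :=
  if n is n'.+1 then cons_measure m (power_measure m n') else nil_measure.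

Lemma power_measureE d (T : measurableType d) (R : realType)
    (m : {sigma_finite_measure set T -> \bar R}) (n : nat) (A : 'I_n -> set T) :
  (forall i, measurable (A i)) ->
  power_measure m n [set x | forall i, A i (tnth x i)] =
  (\prod_(i < n) m (A i))%E.
Proof.
elim: n A => [|n IHn] A mA.
  by rewrite big_ord0 /= /nil_measure diracE mem_set//= => -[].
have mB : measurable [set x : n.-tuple T | forall i, A (lift ord0 i) (tnth x i)].
  rewrite [X in measurable X](_ : _ = \bigcap_(i in [set: 'I_n])
      ((fun x : n.-tuple T => tnth x i) @^-1` A (lift ord0 i))).
    apply: fin_bigcap_measurable => // i _.
    by rewrite -[X in measurable X]setTI; exact: measurable_tnth.
  by apply/seteqP; split => x /= Ax i; [move=> _|]; exact: Ax.
rewrite big_ord_recl -IHn//= -product_measure1E//.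
rewrite /cons_measure /pushforward; congr (_ _).
apply/seteqP; split => -[a b] /= Aab.
  by split; [exact: (Aab ord0)|move=> i; have := Aab (lift ord0 i); rewrite tnthS].
move=> i; case: (unliftP ord0 i) => [j ->|->]; last exact: Aab.1.
by rewrite tnthS; exact: Aab.2.
Qed.

(* R^n is encoded as n-tuples rather than as 'rV[R]_n because only the former
   carry the product sigma-algebra (here, the Borel sets of R^n). *)
Notation Rn R n := (n.-tuple (measurableTypeR R)).

Definition lebesgue_Rn (R : realType) (n : nat) :
    {sigma_finite_measure set (Rn R n) -> \bar R} :=
  power_measure (@lebesgue_measure R) n.

Section heat.
Context {R : realType} {n : nat}.
Implicit Types (x y : Rn R n) (f : Rn R n -> R).

Definition enorm x : R := Num.sqrt (\sum_(i < n) (tnth x i : R) ^+ 2).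

Definition eball (r : R) : set (Rn R n) := [set x | enorm x < r].

Definition japanese x : R := Num.sqrt (1 + enorm x ^+ 2).

Definition subRn x y : Rn R n := [tuple (tnth x i : R) - tnth y i | i < n].

Definition heat_kernel (t : R) x : R :=
  (4 * pi * t) `^ (- (n%:R / 2)) * expR (- (enorm x ^+ 2 / (4 * t))).

Definition heat_semigroup (t : R) f x : R :=
  if t == 0 then f x
  else \int[lebesgue_Rn R n]_y (heat_kernel t (subRn x y) * f y).

(* The values of u at negative times are irrelevant.  For t > 0 the continuous
   representative of e^{t Delta} u(0, .) is the one prescribed. *)
Definition heat_solution (u : R -> Rn R n -> R) : Prop :=
  u 0 \in Lfun (lebesgue_Rn R n) 2%:E /\
  forall t x, 0 <= t -> u t x = heat_semigroup t (u 0) x.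

End heat.

(* Main.v *)
Require Import Defs.
From mathcomp Require Import all_boot all_order all_algebra.
From mathcomp Require Import all_classical all_reals all_analysis.
From mathcomp Require Import measurable_realfun ring lra.

(** The weighted energy on the left sees mass located anywhere in space, and
    [rho] decays at most like [expR (- (p * enorm x))] for some [p >= 0]
    ([japanese_powR_ge] reduces the polynomial weight to this case).  The right
    hand side only sees what the heat flow brings into the fixed ball within
    time [T], and heat coming from distance [a] reaches the ball with Gaussian
    attenuation [expR (- (a ^+ 2 / (4 * T)))].  A bump starting far away
    therefore violates any such inequality, because Gaussian decay beats
    exponential decay.

    The bump is the indicator of a unit cube [Q] shifted by [k = a + r] along
    one coordinate axis.
    - On [Q] itself the solution at time [T] is at least a constant [c]
      that does not depend on [k] ([heat_kernel_ge]), so that the left hand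
      side is at least [c ^+ 2 * expR (- (p * (k + n%:R)))].
    - On the ball the solution is at most
      [expR (- ((a ^+ 2 - n%:R) / (4 * T)))] uniformly in [0 <= t <= T]
      ([heat_kernel_le_expR]), so that the right hand side is at most
      [C * T * (2 * r) ^+ n] times the square of this.
    - [gaussian_decay_dominates] provides an [a] for which these two bounds
      are incompatible.

    All integrands are nonnegative and compared with constants only, so that
    the monotonicity of the integral in the form of [ge0_le_integral_patch]
    suffices for every integral in the argument. *)

Set Implicit Arguments.
Unset Strict Implicit.
Unset Printing Implicit Defensive.

Import Order.TTheory GRing.Theory Num.Theory.
Import numFieldNormedType.Exports.
Local Open Scope classical_set_scope.
Local Open Scope ring_scope.

(** * Comparing nonnegative integrals with constants *)

Section integral_bounds.
Context d (T : measurableType d) (R : realType) (mu : {measure set T -> \bar R}).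
Implicit Types (D E : set T) (f g : T -> \bar R).
Local Open Scope ereal_scope.

(** The integral of a nonnegative function is a supremum over the simple
    functions below it, so monotonicity holds without any measurability.  This
    spares proving that [heat_semigroup t f] is jointly measurable. *)
Lemma ge0_le_integral_patch D E f g :
  (forall x, D x -> 0 <= f x) -> (forall x, E x -> 0 <= g x) ->
  (forall x, (f \_ D) x <= (g \_ E) x) ->
  \int[mu]_(x in D) f x <= \int[mu]_(x in E) g x.
Proof.
move=> f0 g0 fg; rewrite !ge0_integralE//.
apply: ereal_sup_le => _ [h hf <-]; exists h => // x.
exact: le_trans (hf x) (fg x).
Qed.

Lemma integral_le_cst D E f (c : R) : measurable E -> D `<=` E -> (0 <= c)%R ->
  (forall x, D x -> 0 <= f x <= c%:E) ->
  \int[mu]_(x in D) f x <= c%:E * mu E.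
Proof.
move=> mE DE c0 fc; rewrite -integral_cst//.
apply: ge0_le_integral_patch => [x /fc/andP[]//|x _|x]; first by rewrite lee_fin.
rewrite !patchE; case: ifPn => [|_]; last by case: ifPn; rewrite ?lee_fin.
by rewrite inE => Dx; rewrite mem_set; [case/andP: (fc _ Dx)|exact: DE].
Qed.

Lemma integral_ge_cst D E f (c : R) : measurable E -> E `<=` D -> (0 <= c)%R ->
  (forall x, D x -> 0 <= f x) -> (forall x, E x -> c%:E <= f x) ->
  c%:E * mu E <= \int[mu]_(x in D) f x.
Proof.
move=> mE ED c0 f0 fc; rewrite -integral_cst//.
apply: ge0_le_integral_patch => // x.
rewrite !patchE; case: ifPn => [|_].
  by rewrite inE => Ex; rewrite mem_set; [exact: fc|exact: ED].
by case: ifPn => //; rewrite inE => /f0.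
Qed.

End integral_bounds.

(** * Cubes *)

Section cube.
Context (R : realType) (n : nat).
Implicit Types (a : 'I_n -> R) (s : R).

Definition cube a s : set (Rn R n) :=
  [set x | forall i, `[a i, a i + s]%classic (tnth x i)].

Lemma measurable_cube a s : measurable (cube a s).
Proof.
rewrite [X in measurable X](_ : _ = \bigcap_(i in [set: 'I_n])
    ((fun x : Rn R n => tnth x i) @^-1` `[a i, a i + s])).
  apply: fin_bigcap_measurable => // i _.
  rewrite -[X in measurable X]setTI; exact: measurable_tnth.
by apply/seteqP; split => x /= Ax i; [move=> _|]; exact: Ax.
Qed.

Lemma lebesgue_cube a s : 0 <= s -> lebesgue_Rn R n (cube a s) = (s ^+ n)%:E.
Proof.
move=> s0; rewrite /lebesgue_Rn /cube.
rewrite [LHS](@power_measureE _ (measurableTypeR R) R lebesgue_measure n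
  (fun i => `[a i, a i + s]%classic))//.
rewrite (eq_bigr (fun=> s%:E)) => [|i _].
  by rewrite prodEFin prodr_const card_ord.
rewrite [LHS]lebesgue_measure_itv/= lte_fin ltrDl -EFinD addrAC subrr add0r.
by case: ltrgt0P s0 => // ->.
Qed.

Lemma Lfun_indic_cube a s : 0 <= s ->
  (\1_(cube a s) : Rn R n -> R) \in Lfun (lebesgue_Rn R n) 2%:E.
Proof.
move=> s0; have mA := measurable_cube a s.
rewrite inE/=; apply/andP; split; rewrite inE/=; first exact: measurable_indic.
rewrite /finite_norm unlock poweR_lty//.
rewrite (eq_integral (fun x => (\1_(cube a s) x)%:E)) => [|x _].
  by rewrite integral_indic// setIT [ltLHS]lebesgue_cube// ltry.
rewrite /= indicE; case: (_ \in _) => /=; rewrite ?normr1 ?normr0 ?powR1//.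
by rewrite powR0// pnatr_eq0.
Qed.

End cube.

(** * The Euclidean norm and the weights *)

Section enorm.
Context {R : realType} {n : nat}.
Implicit Types (x y : Rn R n).

Lemma enorm_ge0 x : 0 <= enorm x. Proof. exact: sqrtr_ge0. Qed.

Lemma normr_tnth_le_enorm x (i : 'I_n) : `|(tnth x i : R)| <= enorm x.
Proof.
rewrite -sqrtr_sqr; apply: ler_wsqrtr; rewrite (bigD1 i)//= lerDl.
by apply: sumr_ge0 => j _; exact: sqr_ge0.
Qed.

Lemma enorm_le_sum x : enorm x <= \sum_(i < n) `|(tnth x i : R)|.
Proof.
have s0 : 0 <= \sum_(i < n) `|(tnth x i : R)| by exact: sumr_ge0.
rewrite -[leRHS]ger0_norm// -sqrtr_sqr; apply: ler_wsqrtr.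
rewrite expr2 mulr_sumr; apply: ler_sum => i _.
rewrite -real_normK ?num_real// expr2 ler_wpM2r// (bigD1 i)//= lerDl.
exact: sumr_ge0.
Qed.

Lemma sqr_enorm x : enorm x ^+ 2 = \sum_(i < n) (tnth x i : R) ^+ 2.
Proof. by rewrite sqr_sqrtr// sumr_ge0// => i _; exact: sqr_ge0. Qed.

Lemma japanese_le_expR x : japanese x <= expR (enorm x).
Proof.
apply: le_trans (expR_ge1Dx _); have x0 := enorm_ge0 x.
rewrite -[leRHS]ger0_norm ?addr_ge0// -sqrtr_sqr; apply: ler_wsqrtr.
nra.
Qed.

Lemma japanese_gt0 x : 0 < japanese x.
Proof. by rewrite sqrtr_gt0 ltr_pwDl// sqr_ge0. Qed.

(** Lets both weights be treated as one: a polynomial weight is bounded below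
    by an exponential one, since [japanese x <= 1 + enorm x <= expR (enorm x)]. *)
Lemma japanese_powR_ge (nu : R) x : 0 <= nu ->
  expR (- (nu * enorm x)) <= japanese x `^ (- nu).
Proof.
move=> nu0; rewrite /powR gt_eqF ?japanese_gt0// ler_expR mulNr lerN2 ler_wpM2l//.
by rewrite -[leRHS]expRK ler_ln ?posrE ?expR_gt0 ?japanese_gt0 ?japanese_le_expR.
Qed.

End enorm.

(** * Bounds on the heat kernel and the heat semigroup *)

(** From [ln y^-1 <= y^-1].  It lets the Gaussian factor of the heat kernel
    absorb the prefactor that blows up as the time tends to 0. *)
Lemma powRN_le_expR (R : realType) (y p : R) : 0 < y -> 0 <= p ->
  y `^ (- p) <= expR (p / y).
Proof.
move=> y0 p0; rewrite /powR gt_eqF// ler_expR mulNr -mulrN ler_wpM2l// -lnV ?posrE//.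
by rewrite ltW// ln_sublinear// invr_gt0.
Qed.

Section heat_kernel_bounds.
Context {R : realType} {n : nat}.
Implicit Types (x y z : Rn R n).

Lemma heat_kernel_ge0 t z : 0 <= heat_kernel t z.
Proof. by rewrite mulr_ge0// ?powR_ge0// expR_ge0. Qed.

(** The prefactor is at most [expR (n%:R / (8 * pi * t))], which costs only a
    shift of [a ^+ 2] by [n%:R] in the exponent.  The resulting exponent
    [- ((a ^+ 2 - n%:R) / (4 * t))] is then nondecreasing in [t], hence the
    bound at time [T] is valid at all earlier times. *)
Lemma heat_kernel_le_expR (t T a : R) z : 0 < t -> t <= T -> n%:R <= a ^+ 2 ->
  0 <= a -> a <= enorm z ->
  heat_kernel t z <= expR (- ((a ^+ 2 - n%:R) / (4 * T))).
Proof.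
move=> t0 tT na a0 az; have pi1 : 2 <= pi :> R by exact: pi_ge2.
have T0 : 0 < T by exact: lt_le_trans tT.
have pt0 : 0 < 4 * pi * t by nra.
apply: (@le_trans _ _ (expR (n%:R / 2 / (4 * pi * t)) * expR (- (enorm z ^+ 2 / (4 * t))))).
  by rewrite ler_wpM2r ?expR_ge0// powRN_le_expR// divr_ge0.
rewrite -expRD ler_expR.
have n0 : 0 <= n%:R :> R by [].
have -> : n%:R / 2 / (4 * pi * t) = (n%:R / (2 * pi)) / (4 * t) :> R.
  by field; rewrite !gt_eqF//; lra.
rewrite -[leLHS]mulrBl -[leRHS]mulNr opprB.
apply: (@le_trans _ _ ((n%:R - a ^+ 2) / (4 * t))).
  rewrite ler_wpM2r ?invr_ge0 ?mulr_ge0 ?(ltW t0)//.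
  rewrite lerD//; last by rewrite lerN2 ler_sqr ?nnegrE// (le_trans a0).
  by rewrite ler_pdivrMr; nra.
rewrite -[n%:R - _]opprB !mulNr lerN2 ler_wpM2l ?subr_ge0//.
by rewrite lef_pV2 ?posrE ?mulr_gt0// ler_wpM2l.
Qed.

Lemma heat_kernel_ge (t b : R) z : 0 < t -> enorm z ^+ 2 <= b ->
  (4 * pi * t) `^ (- (n%:R / 2)) * expR (- (b / (4 * t))) <= heat_kernel t z.
Proof.
move=> t0 zb; rewrite ler_wpM2l ?powR_ge0// ler_expR lerN2 ler_wpM2r//.
by rewrite invr_ge0 mulr_ge0// ltW.
Qed.

Lemma heat_kernel_le (t : R) z : 0 <= t ->
  heat_kernel t z <= (4 * pi * t) `^ (- (n%:R / 2)).
Proof.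
move=> t0; rewrite ler_piMr ?powR_ge0// -[leRHS]expR0 ler_expR oppr_le0.
by rewrite divr_ge0 ?sqr_ge0 ?mulr_ge0.
Qed.

(** The semigroup applied to the indicator of a set of volume 1 is an average
    of the heat kernel over this set.  The upper bound [M] is also what makes
    the lower bound meaningful: it ensures that the real-valued integral is not
    the default value of a divergent one. *)
Lemma heat_semigroup_indic_bounds (t : R) (A : set (Rn R n)) x (m M : R) :
  t != 0 -> measurable A -> lebesgue_Rn R n A = 1%E -> 0 <= m ->
  (forall y, A y -> m <= heat_kernel t (subRn x y) <= M) ->
  m <= heat_semigroup t \1_A x <= M.
Proof.
move=> t0 mA A1 m0 KM; rewrite /heat_semigroup (negbTE t0).
have [y Ay] : A !=set0.
  by apply/set0P; apply: contra_eqN A1 => /eqP ->; rewrite measure0 eq_sym onee_neq0.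
have /andP[mK KM'] := KM _ Ay; have M0 : 0 <= M by rewrite (le_trans m0)// (le_trans mK).
pose I := (\int[lebesgue_Rn R n]_y (heat_kernel t (subRn x y) * \1_A y)%:E)%E.
have IE : I = (\int[lebesgue_Rn R n]_(y in A) (heat_kernel t (subRn x y))%:E)%E.
  rewrite [RHS]integral_mkcond; apply: eq_integral => z _.
  by rewrite patchE indicE; case: (_ \in _); rewrite ?mulr1 ?mulr0.
have lI : (m%:E <= I)%E.
  rewrite -[leLHS]mule1 -A1 IE; apply: integral_ge_cst => // z Az.
    by rewrite lee_fin heat_kernel_ge0.
  by rewrite lee_fin; case/andP: (KM _ Az).
have uI : (I <= M%:E)%E.
  rewrite -[leRHS]mule1 -A1 IE; apply: integral_le_cst => // z Az.
  by rewrite !lee_fin heat_kernel_ge0; case/andP: (KM _ Az).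
rewrite /Rintegral -/I; case: I lI uI {IE} => [i| |] //=.
by rewrite !lee_fin => -> ->.
Qed.

End heat_kernel_bounds.

(** * Gaussian decay against exponential decay *)

(** The exponent on the left is quadratic in [a], the one on the right only
    linear, so any large enough [a] works, whatever the factor [A]. *)
Lemma gaussian_decay_dominates (R : realType) (A p b N T : R) :
  0 <= A -> 0 <= p -> 0 <= b -> 0 <= N -> 0 < T ->
  exists2 a : R, 0 <= a /\ N <= a ^+ 2 &
    A * expR (- ((a ^+ 2 - N) / (2 * T))) < expR (- (p * (a + b))).
Proof.
move=> A0 p0 b0 N0 T0.
have Tp0 : 0 <= T * p by rewrite mulr_ge0// ltW.
have Tpb0 : 0 <= T * (p * b + A) by rewrite mulr_ge0 ?(ltW T0)// addr_ge0// mulr_ge0.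
(* Chosen so that each summand of [a], multiplied by [a >= 1], pays for one
   term of [N + 2 * T * (A + p * (a + b))]. *)
pose X := T * p; pose Y := T * (p * b + A).
pose a := 1 + N + 2 * X + 2 * Y.
have [X0 Y0] : 0 <= X /\ 0 <= Y by [].
have a1 : 1 <= a by rewrite /a; lra.
have a2 : N + 2 * X * a + 2 * Y <= a ^+ 2.
  have -> : a ^+ 2 = (1 + N + 2 * X + 2 * Y) * a by rewrite expr2.
  nra.
have Xa : 0 <= X * a by rewrite mulr_ge0//; lra.
exists a; first by split; lra.
set z := (a ^+ 2 - N) / (2 * T).
have Az : A + p * (a + b) <= z.
  rewrite ler_pdivlMr ?mulr_gt0// lerBrDl; apply: le_trans a2.
  by rewrite /X /Y le_eqVlt; apply/orP; left; apply/eqP; ring.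
apply: (@lt_le_trans _ _ (expR (z - p * (a + b)) * expR (- z))).
  rewrite ltr_pM2r ?expR_gt0//; apply: lt_le_trans (expR_ge1Dx _); lra.
by rewrite -expRD ler_expR; lra.
Qed.

(** * A unit cube far away along one axis *)

Section far_cube.
Context (R : realType) (n : nat) (i0 : 'I_n).
Implicit Types (x y : Rn R n) (k : R).

Definition far_cube k : set (Rn R n) := cube (fun i => if i == i0 then k else 0) 1.

Lemma enorm_far_cube_le k x : 0 <= k -> far_cube k x -> enorm x <= k + n%:R.
Proof.
move=> k0 Qx; apply: le_trans (enorm_le_sum _) _.
apply: (@le_trans _ _ (\sum_(i < n) ((if i == i0 then k else 0) + 1))).
  apply: ler_sum => i _; have := Qx i; rewrite /= in_itv/= => /andP[].
  by case: ifP => _ ? ?; rewrite ger0_norm//; lra.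
by rewrite big_split/= -big_mkcond/= big_pred1_eq sumr_const card_ord.
Qed.

Lemma enorm_sub_far_cube_le k x y : far_cube k x -> far_cube k y ->
  enorm (subRn x y) ^+ 2 <= n%:R.
Proof.
move=> Qx Qy; rewrite sqr_enorm -[n in leRHS]card_ord -sumr_const.
apply: ler_sum => i _; rewrite tnth_mktuple.
have := Qx i; have := Qy i; rewrite /= !in_itv/= => /andP[? ?] /andP[? ?].
set d := (tnth x i : R) - _; have [? ?] : -1 <= d /\ d <= 1 by rewrite /d; split; lra.
nra.
Qed.

Lemma enorm_sub_far_cube_ge k r x y : eball r x -> far_cube k y ->
  k - r <= enorm (subRn x y).
Proof.
move=> xr /(_ i0); rewrite /= eqxx in_itv/= => /andP[ky _].
have := le_lt_trans (normr_tnth_le_enorm x i0) xr.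
rewrite ltr_norml => /andP[_ xlt].
apply: le_trans (normr_tnth_le_enorm _ i0); rewrite tnth_mktuple distrC.
by apply: le_trans (ler_norm _); lra.
Qed.

End far_cube.

Lemma eball_sub_cube (R : realType) (n : nat) (r : R) :
  @eball R n r `<=` cube (fun=> - r) (2 * r).
Proof.
move=> x xr i; rewrite /= in_itv/=.
have := le_lt_trans (normr_tnth_le_enorm x i) xr.
by rewrite ltr_norml => /andP[? ?]; lra.
Qed.

(** * Failure of the weighted observability inequality *)

Theorem corollary3p2 (R : realType) (n : nat) (nu T r : R)
    (rho : Rn R n -> R)
    (n_gt0 : (0 < n)%N) (nu_gt0 : 0 < nu) (T_gt0 : 0 < T) (r_gt0 : 0 < r)
    (rhoE : (forall x, rho x = japanese x `^ (- nu)) \/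
            (forall x, rho x = expR (- enorm x))) :
  ~ (exists C : R, 0 < C /\
      forall u : R -> Rn R n -> R, heat_solution u ->
        (\int[lebesgue_Rn R n]_x (u T x ^+ 2 * rho x)%:E <=
         C%:E * \int[lebesgue_measure]_(t in `[0%R, T])
                  \int[lebesgue_Rn R n]_(x in eball r) (u t x ^+ 2)%:E)%E).
Proof.
move=> [C [C0 observable]].
have [p p0 rho_ge] : exists2 p : R, 0 <= p & forall x, expR (- (p * enorm x)) <= rho x.
  case: rhoE => rhoE; last by exists 1 => // x; rewrite rhoE mul1r.
  by exists nu => [|x]; rewrite ?rhoE ?japanese_powR_ge ?(ltW nu_gt0).
pose c := (4 * pi * T) `^ (- (n%:R / 2)) * expR (- (n%:R / (4 * T))).
have c0 : 0 < c.
  by rewrite mulr_gt0 ?expR_gt0// powR_gt0// mulr_gt0// mulr_gt0// pi_gt0.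
pose V := (2 * r) ^+ n.
have V0 : 0 <= V by rewrite exprn_ge0// mulr_ge0// ltW.
have [|||a [a0 na] aA] := @gaussian_decay_dominates R (C * (T * V) / c ^+ 2) p
    (r + n%:R) n%:R T _ p0 _ _ T_gt0.
- by rewrite divr_ge0 ?sqr_ge0// mulr_ge0 ?(ltW C0)// mulr_ge0// ltW.
- by rewrite addr_ge0// ltW.
- by [].
pose k := a + r; have k0 : 0 <= k by rewrite addr_ge0// ltW.
pose i0 := Ordinal n_gt0; pose Q := far_cube i0 k.
have mQ : measurable Q by exact: measurable_cube.
have Q1 : lebesgue_Rn R n Q = 1%E by rewrite [LHS]lebesgue_cube// expr1n.
pose u t := heat_semigroup t (\1_Q : Rn R n -> R).
have u0E : u 0 = \1_Q by apply/funext => x; rewrite /u /heat_semigroup eqxx.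
have uS : heat_solution u.
  by split; rewrite ?u0E//; exact: Lfun_indic_cube.
pose M := expR (- ((a ^+ 2 - n%:R) / (4 * T))).
have u_le t x : 0 <= t <= T -> eball r x -> 0 <= u t x <= M.
  (* At time 0 the solution is the indicator of [Q], which misses the ball. *)
  move=> /andP[]; rewrite le_eqVlt => /predU1P[<- _|t0 tT] xr.
    rewrite u0E indicE memNset ?lexx ?expR_ge0// => Qx.
    have /= := Qx i0; rewrite in_itv/= => /andP[kx _].
    have := le_lt_trans (normr_tnth_le_enorm x i0) xr.
    by rewrite ltr_norml => /andP[_]; rewrite /k in kx; lra.
  apply: heat_semigroup_indic_bounds => //; first by rewrite gt_eqF.
  move=> y Qy; rewrite heat_kernel_ge0/=; apply: heat_kernel_le_expR => //.
  by rewrite -(addrK r a); exact: enorm_sub_far_cube_ge xr Qy.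
have u_ge x : Q x -> c <= u T x.
  move=> Qx.
  have /(_ _ _ _ _ _)/andP[] := @heat_semigroup_indic_bounds _ _ T Q x c
    ((4 * pi * T) `^ (- (n%:R / 2))) => //; first by rewrite gt_eqF.
    exact: ltW.
  move=> y Qy; rewrite heat_kernel_le ?(ltW T_gt0)// andbT.
  by apply: heat_kernel_ge => //; exact: enorm_sub_far_cube_le Qx Qy.
have lower : ((c ^+ 2 * expR (- (p * (k + n%:R))))%:E <=
    \int[lebesgue_Rn R n]_x (u T x ^+ 2 * rho x)%:E)%E.
  rewrite -[leLHS]mule1 -Q1; apply: integral_ge_cst => //.
  - by rewrite mulr_ge0 ?sqr_ge0 ?expR_ge0.
  - move=> x _; rewrite lee_fin mulr_ge0 ?sqr_ge0//.
    by rewrite (le_trans (expR_ge0 _) (rho_ge x)).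
  - move=> x Qx; rewrite lee_fin ler_pM ?sqr_ge0 ?expR_ge0//.
      by rewrite ler_sqr ?nnegrE ?u_ge// ltW// (lt_le_trans c0)// u_ge.
    apply: le_trans (rho_ge x); rewrite ler_expR lerN2 ler_wpM2l//.
    exact: enorm_far_cube_le k0 Qx.
have upper : (\int[lebesgue_measure]_(t in `[0%R, T])
    \int[lebesgue_Rn R n]_(x in eball r) (u t x ^+ 2)%:E <=
    (M ^+ 2 * V * T)%:E)%E.
  have -> : ((M ^+ 2 * V * T)%:E =
      (M ^+ 2 * V)%:E * (lebesgue_measure `[0%R, T] : \bar R))%E.
    by rewrite lebesgue_measure_itv/= lte_fin T_gt0 sube0.
  apply: integral_le_cst => //; first by rewrite mulr_ge0 ?sqr_ge0.
  move=> t; rewrite /= in_itv/= => t0T; apply/andP; split.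
    by apply: integral_ge0 => x _; rewrite lee_fin sqr_ge0.
  have -> : ((M ^+ 2 * V)%:E =
      (M ^+ 2)%:E * lebesgue_Rn R n (cube (fun=> (- r)%R) (2 * r)))%E.
    by rewrite lebesgue_cube ?EFinM// mulr_ge0// ltW.
  apply: integral_le_cst; [exact: measurable_cube|exact: eball_sub_cube| |].
    exact: sqr_ge0.
  move=> x xr; have /andP[u0 uM] := u_le t x t0T xr.
  by rewrite !lee_fin sqr_ge0 ler_sqr// nnegrE expR_ge0.
have := le_trans lower (le_trans (observable u uS) (lee_wpmul2l _ upper)).
rewrite lee_fin (ltW C0) => /(_ isT).
rewrite -EFinM lee_fin leNgt => /negP; apply.
have -> : M ^+ 2 = expR (- ((a ^+ 2 - n%:R) / (2 * T))).
  by rewrite -expRM_natl; congr expR; field; rewrite gt_eqF.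
move: aA; rewrite addrA -/k mulrAC ltr_pdivrMr ?exprn_gt0// [ltRHS]mulrC.
by congr (_ < _); ring.
Qed.
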